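(* Let $\mathbb C_\omega=\mathbb Q\times\omega$ with $\langle q_1,i_1\rangle<\langle q_2,i_2\rangle$ iff $q_1<_{\mathbb Q}q_2$. For each $\mathbb R$-embeddable complete linear order $L$ whose least element $0_L$ is non-isolated, there is a maximal chain in $\langle\mathbb P(\mathbb C_\omega)\cup\{\emptyset\},\subset\rangle$ isomorphic to $L$.
   Context: $\mathbb P(\mathbb X)$ is the set of subsets of the domain of $\mathbb X$ whose induced suborder is isomorphic to $\mathbb X$. A linear order is complete if it has a least element $0_L$, a greatest element and no gaps; $0_L$ is non-isolated if it has no immediate successor; $\mathbb R$-embeddable means embeddable into $\langle\mathbb R,<\rangle$.
   Formalization: ''Non-isolated'' is taken to require also that L has an element above its least element: the one-point order has no immediate successor of its least element, but the claim fails for it, since the chain consisting of the empty set alone is not maximal. *)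

(* Defs.v *)
From HB Require Import structures.
From mathcomp Require Import all_boot all_order all_algebra.
From mathcomp Require Import boolp classical_sets functions reals.

Set Implicit Arguments.
Unset Strict Implicit.
Unset Printing Implicit Defensive.

Local Open Scope classical_set_scope.

Definition suborder_iso (T U : Type) (A : set T) (rT : T -> T -> Prop)
    (B : set U) (rU : U -> U -> Prop) : Prop :=
  exists f : T -> U, set_bij A B f /\
    forall x y, A x -> A y -> (rT x y <-> rU (f x) (f y)).

Definition copies (T : Type) (r : T -> T -> Prop) : set (set T) :=
  [set A | suborder_iso A r setT r].

Definition Comega : Type := (rat * nat)%type.

Definition Comega_lt (x y : Comega) : Prop := (x.1 < y.1)%R.

Definition chain_in (T : Type) (P C : set (set T)) : Prop :=
  C `<=` P /\
  forall A B, C A -> C B -> A = B \/ A `<` B \/ B `<` A.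

Definition maximal_chain_in (T : Type) (P C : set (set T)) : Prop :=
  chain_in P C /\ forall D, chain_in P D -> C `<=` D -> D = C.

Section LinearOrders.
Local Open Scope order_scope.
Variables (d : Order.disp_t) (L : orderType d).

Definition is_least (A : set L) (z : L) : Prop :=
  A z /\ forall x, A x -> z <= x.

Definition is_greatest (A : set L) (z : L) : Prop :=
  A z /\ forall x, A x -> x <= z.

Definition is_cut (A B : set L) : Prop :=
  [/\ A !=set0, B !=set0, A `|` B = setT &
      forall a b, A a -> B b -> a < b].

Definition is_gap (A B : set L) : Prop :=
  [/\ is_cut A B, ~ (exists a, is_greatest A a) &
      ~ (exists b, is_least B b)].

Definition complete_order : Prop :=
  [/\ exists z, is_least setT z, exists z, is_greatest setT z &
      forall A B, ~ is_gap A B].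

Definition immediate_succ (x y : L) : Prop :=
  x < y /\ ~ (exists t, x < t /\ t < y).

(* For the least element [z], this is non-isolation in the order topology.
   The first clause excludes the one-point order, whose only point has no
   immediate successor but is isolated. *)
Definition non_isolated_least (z : L) : Prop :=
  [/\ is_least setT z, exists x, z < x & ~ (exists y, immediate_succ z y)].

Definition embeddable_in_reals (R : realType) : Prop :=
  exists f : L -> R, forall x y, (x < y) <-> (f x < f y)%R.

End LinearOrders.

Arguments complete_order {d} L.
Arguments embeddable_in_reals {d} L R.

(* Main.v *)
Require Import Defs.
From HB Require Import structures.
From mathcomp Require Import all_boot all_order all_algebra.
From mathcomp Require Import boolp classical_sets functions reals.

(** Give every point [c] of C_omega a label [t c] in [L], and let the level of
    [x] be the set of points whose label is below [x], or equal to [x] when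
    [x] has an immediate predecessor.  Levels form a maximal chain isomorphic
    to [L] as soon as every level above the least element is a copy, every
    successor labels exactly one point, and every other label is a right limit
    whose points are maximal, in C_omega, among the points with smaller or
    equal label (so that adding some of them to the level never yields a copy).

    Labels are the successors of [L] (countably many, each used once) and a
    countable set [E], dense in itself and dense in the jump-free intervals of
    [L], each element of which labels a whole infinite block.  The blocks of
    [E] are ordered as in [L].  If [E] is coinitial at [0_L], each successor
    [j] is put in the block of some element of [E] below [j].  Otherwise the
    successors are coinitial at [0_L]; they are then distributed among
    additional blocks, ordered like the rationals and placed below those of
    [E], so that each of these blocks has labels arbitrarily close to [0_L].
    All levels above [0_L] are then countable unions of infinite blocks, with
    the blocks densely ordered without endpoints, hence copies of C_omega by
    back-and-forth. *)

Set Implicit Arguments.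
Unset Strict Implicit.
Unset Printing Implicit Defensive.
Import Order.TTheory GRing.Theory Num.Theory.
Local Open Scope classical_set_scope.

(** * Back-and-forth for countable dense orders of infinite blocks *)

Section DenseBlocks.
Local Open Scope order_scope.

(** The blocks are the fibres of [s]. Their infinity is stated in the form used by the
    back-and-forth: a block always has a point outside a given finite list. *)
Definition dense_blocks d (O : orderType d) (T : eqType) (A : set T)
    (s : T -> O) : Prop :=
  [/\ A !=set0,
      forall p, A p -> exists2 p', A p' & s p < s p',
      forall p, A p -> exists2 p', A p' & s p' < s p,
      forall p q, A p -> A q -> s p < s q ->
        exists2 r, A r & s p < s r /\ s r < s q &
      forall p, A p -> forall l : seq T,
        exists2 p', A p' & s p' = s p /\ p' \notin l].

Definition coded T (A : set T) : Prop :=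
  exists k : T -> nat, forall x y, A x -> A y -> k x = k y -> x = y.

Section Interpolation.
Context d (O : orderType d) (T : eqType) (A : set T) (s : T -> O).

Lemma seq_max_by (l : seq T) : l != [::] ->
  exists2 m, m \in l & {in l, forall x, s x <= s m}.
Proof.
elim: l => // a [|b l] IH _.
  by exists a; rewrite ?mem_head // => x; rewrite inE => /eqP ->.
have [//|m ml mP] := IH.
have [ma|am] := leP (s m) (s a).
  exists a; rewrite ?mem_head // => x; rewrite inE => /orP[/eqP -> //|xl].
  exact: le_trans (mP _ xl) ma.
exists m; first by rewrite inE ml orbT.
move=> x; rewrite inE => /orP[/eqP ->|xl]; [exact: ltW|exact: mP].
Qed.

Lemma seq_min_by (l : seq T) : l != [::] ->
  exists2 m, m \in l & {in l, forall x, s m <= s x}.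
Proof.
elim: l => // a [|b l] IH _.
  by exists a; rewrite ?mem_head // => x; rewrite inE => /eqP ->.
have [//|m ml mP] := IH.
have [ma|am] := leP (s a) (s m).
  exists a; rewrite ?mem_head // => x; rewrite inE => /orP[/eqP -> //|xl].
  exact: le_trans ma (mP _ xl).
exists m; first by rewrite inE ml orbT.
move=> x; rewrite inE => /orP[/eqP ->|xl]; [exact: ltW|exact: mP].
Qed.

Lemma dense_blocks_between (lo hi : seq T) : dense_blocks A s ->
  {in lo, forall x, A x} -> {in hi, forall x, A x} ->
  (forall x y, x \in lo -> y \in hi -> s x < s y) ->
  exists2 p, A p & {in lo, forall x, s x < s p} /\
                   {in hi, forall y, s p < s y}.
Proof.
move=> [[p0 Ap0] noMax noMin dense _] Alo Ahi lohi.
have [lo0|/seq_max_by[m mlo mP]] := eqVneq lo [::];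
  have [hi0|/seq_min_by[n nhi nP]] := eqVneq hi [::].
- by exists p0 => //; rewrite lo0 hi0.
- have [p Ap pn] := noMin _ (Ahi _ nhi).
  exists p => //; split=> [x|y /nP]; first by rewrite lo0.
  exact: lt_le_trans.
- have [p Ap mp] := noMax _ (Alo _ mlo).
  exists p => //; split=> [x /mP xm|y]; last by rewrite hi0.
  exact: le_lt_trans mp.
- have [p Ap [mp pn]] := dense _ _ (Alo _ mlo) (Ahi _ nhi) (lohi _ _ mlo nhi).
  exists p => //; split=> [x /mP xm|y /nP]; first exact: le_lt_trans mp.
  exact: lt_le_trans.
Qed.

End Interpolation.

(** A finite partial isomorphism, given by its graph. Applied to [(p, q)] and [(q, p)], the clause
    on [<] also makes it respect blocks. *)
Definition finite_iso d (O : orderType d) (T : eqType) (A : set T) (s : T -> O)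
    d' (O' : orderType d') (T' : eqType) (A' : set T') (s' : T' -> O')
    (l : seq (T * T')) : Prop :=
  {in l, forall p, A p.1 /\ A' p.2} /\
  {in l &, forall p q, ((p.1 == q.1) = (p.2 == q.2)) *
                       ((s p.1 < s q.1) = (s' p.2 < s' q.2))}.

Definition swap_seq (T T' : Type) (l : seq (T * T')) : seq (T' * T) :=
  [seq (p.2, p.1) | p <- l].

Lemma mem_swap_seq (T T' : eqType) (l : seq (T * T')) a b :
  ((b, a) \in swap_seq l) = ((a, b) \in l).
Proof. by apply/mapP/idP => [[[x y] ? [-> ->]] //|?]; exists (a, b). Qed.

Lemma finite_iso_swap d (O : orderType d) (T : eqType) (A : set T) (s : T -> O)
    d' (O' : orderType d') (T' : eqType) (A' : set T') (s' : T' -> O') l :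
  finite_iso A s A' s' l -> finite_iso A' s' A s (swap_seq l).
Proof.
move=> [lA lP]; split=> [[b a]|[b a] [b' a']].
  by rewrite mem_swap_seq => /lA[].
by rewrite !mem_swap_seq => h h'; have [-> ->] := lP _ _ h h'.
Qed.

Lemma finite_iso_forth d (O : orderType d) (T : eqType) (A : set T) (s : T -> O)
    d' (O' : orderType d') (T' : eqType) (A' : set T') (s' : T' -> O') l a :
  dense_blocks A' s' -> finite_iso A s A' s' l -> A a ->
  exists b, finite_iso A s A' s' ((a, b) :: l).
Proof.
move=> gA' [lA lP] Aa.
suff [b A'b bP] : exists2 b, A' b & {in l, forall p,
    [/\ (p.1 == a) = (p.2 == b), (s p.1 < s a) = (s' p.2 < s' b) &
        (s a < s p.1) = (s' b < s' p.2)]}.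
  exists b; split=> [p|p q]; rewrite !inE.
    by case/orP => [/eqP ->|/lA].
  case/orP => [/eqP ->|pl]; case/orP => [/eqP ->|ql] /=.
  - by rewrite !eqxx !ltxx.
  - by have [h1 h2 h3] := bP _ ql; rewrite eq_sym h1 h3 eq_sym.
  - by have [h1 h2 h3] := bP _ pl; rewrite h1 h2.
  - exact: lP.
(* If [a] is already matched, its partner serves again. *)
have [[b ab]|nab] := pselect (exists b, (a, b) \in l).
  exists b; first by have [] := lA _ ab.
  move=> p pl; have [-> ->] := lP _ _ pl ab.
  by have [_ ->] := lP _ _ ab pl.
have fresh p : p \in l -> (p.1 == a) = false.
  move=> pl; apply/negP => /eqP pa; apply: nab; exists p.2.
  by rewrite -pa -surjective_pairing.
(* If only the block of [a] is already met, a fresh point of the matching block is taken. *)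
have [[p0 p0l sp0]|nsa] := pselect (exists2 p, p \in l & s p.1 = s a).
  have [_ _ _ _ /(_ p0.2)] := gA'.
  have [_ A'p0] := lA _ p0l.
  move=> /(_ A'p0 [seq p.2 | p <- l])[b A'b [sb bl]].
  exists b => // p pl; have [_] := lP _ _ pl p0l; have [_] := lP _ _ p0l pl.
  rewrite sp0 -sb => -> ->; split=> //; rewrite fresh //; apply/esym/negP.
  by move=> /eqP pb; move: bl; rewrite -pb => /negP; apply; exact: map_f.
(* Otherwise [b] comes from a block strictly between the partners of the points below [a] and of
   those above [a]. *)
pose lo := [seq p.2 | p <- l & s p.1 < s a].
pose hi := [seq p.2 | p <- l & s a < s p.1].
have [||x y|b A'b [bl bh]] := @dense_blocks_between _ _ _ _ s' lo hi gA'.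
- by move=> x /mapP[p]; rewrite mem_filter => /andP[_ /lA[_ ?] ->].
- by move=> x /mapP[p]; rewrite mem_filter => /andP[_ /lA[_ ?] ->].
- move=> /mapP[p]; rewrite mem_filter => /andP[pa pl ->].
  move=> /mapP[q]; rewrite mem_filter => /andP[aq ql ->].
  by have [_ <-] := lP _ _ pl ql; exact: lt_trans aq.
exists b => // p pl; rewrite fresh //.
have [spa|sap|e] := ltgtP (s p.1) (s a); last by case: nsa; exists p.
- have pb : s' p.2 < s' b.
    by apply: bl; apply: map_f; rewrite mem_filter spa.
  rewrite pb ltNge (ltW pb); split=> //.
  by apply/esym/negP => /eqP h; move: pb; rewrite h ltxx.
- have pb : s' b < s' p.2.
    by apply: bh; apply: map_f; rewrite mem_filter sap.
  rewrite pb ltNge (ltW pb); split=> //.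
  by apply/esym/negP => /eqP h; move: pb; rewrite h ltxx.
Qed.

Lemma finite_iso_extend
    d (O : orderType d) (T : eqType) (A : set T) (s : T -> O) (k : T -> nat)
    d' (O' : orderType d') (T' : eqType) (A' : set T') (s' : T' -> O') l n :
  (forall x y, A x -> A y -> k x = k y -> x = y) ->
  dense_blocks A' s' -> finite_iso A s A' s' l ->
  exists l', [/\ finite_iso A s A' s' l', {subset l <= l'} &
    forall a, A a -> k a = n -> exists b, (a, b) \in l'].
Proof.
move=> kI gA' lI.
have [[a [Aa kan]]|nk] := pselect (exists a, A a /\ k a = n); last first.
  by exists l; split=> // a Aa ka; case: nk; exists a.
have [b bI] := finite_iso_forth gA' lI Aa.
exists ((a, b) :: l); split=> //; first by move=> p pl; rewrite inE pl orbT.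
move=> a' Aa' ka'; exists b.
by rewrite (kI _ _ Aa' Aa _) ?mem_head // ka' kan.
Qed.

(** Stage [n] adds the points of code [n] on both sides, the second one through [swap_seq]. The
    union [G] of the stages is the graph of the isomorphism. *)
Theorem dense_blocks_iso
    d (O : orderType d) (T : eqType) (A : set T) (s : T -> O)
    d' (O' : orderType d') (T' : eqType) (A' : set T') (s' : T' -> O') :
  coded A -> coded A' -> dense_blocks A s -> dense_blocks A' s' ->
  suborder_iso A (fun x y => s x < s y) A' (fun x y => s' x < s' y).
Proof.
move=> [k kI] [k' k'I] gA gA'.
have step (nl : nat * {l | finite_iso A s A' s' l}) :
    exists l' : {l | finite_iso A s A' s' l},
    [/\ {subset sval nl.2 <= sval l'},
      forall a, A a -> k a = nl.1 -> exists b, (a, b) \in sval l' &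
      forall b, A' b -> k' b = nl.1 -> exists a, (a, b) \in sval l'].
  case: nl => n [l lI] /=.
  have [l1 [l1I ll1 l1k]] := finite_iso_extend n kI gA' lI.
  have [l2 [l2I ll2 l2k]] := finite_iso_extend n k'I gA (finite_iso_swap l1I).
  exists (exist _ _ (finite_iso_swap l2I)) => /=; split.
  - by move=> -[a b] /ll1 ab; rewrite mem_swap_seq; apply: ll2;
    rewrite mem_swap_seq.
  - move=> a Aa /(l1k _ Aa)[b ab]; exists b.
    by rewrite mem_swap_seq; apply: ll2; rewrite mem_swap_seq.
  - by move=> b A'b /(l2k _ A'b)[a ab]; exists a; rewrite mem_swap_seq.
have [next nextP] := choice step.
have nilI : finite_iso A s A' s' [::] by split.
pose ls := fix ls n := if n is m.+1 then next (m, ls m) else exist _ _ nilI.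
have lsS n m : (n <= m)%N -> {subset sval (ls n) <= sval (ls m)}.
  elim: m => [|m IH]; first by rewrite leqn0 => /eqP ->.
  rewrite leq_eqVlt => /orP[/eqP -> //|/IH nm] p /nm pm.
  by have [h _ _] := nextP (m, ls m); exact: h.
pose G a b := exists n, (a, b) \in sval (ls n).
have GP a b a' b' : G a b -> G a' b' ->
    ((a == a') = (b == b')) * ((s a < s a') = (s' b < s' b')).
  move=> [n h] [m h'].
  have [_ lP] := svalP (ls (maxn n m)).
  exact: (lP (a, b) (a', b') (lsS _ _ (leq_maxl _ _) _ h)
    (lsS _ _ (leq_maxr _ _) _ h')).
have GA a b : G a b -> A a /\ A' b.
  by move=> [n]; have [lA _] := svalP (ls n) => /lA.
have Gl a : A a -> exists b, G a b.
  move=> Aa; have [_ h _] := nextP (k a, ls (k a)).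
  by have [b ab] := h _ Aa erefl; exists b, (k a).+1.
have Gr b : A' b -> exists a, G a b.
  move=> A'b; have [_ _ h] := nextP (k' b, ls (k' b)).
  by have [a ab] := h _ A'b erefl; exists a, (k' b).+1.
have [[b0 _] _ _ _ _] := gA'.
have /choice[f fP] : forall a, exists b, A a -> G a b.
  by move=> a; have [/Gl[b]|nA] := pselect (A a); [exists b | exists b0].
exists f; split; last first.
  by move=> x y Ax Ay; have [_ ->] := GP _ _ _ _ (fP _ Ax) (fP _ Ay).
split=> [a Aa|a a'|b A'b].
- by have [] := GA _ _ (fP _ Aa).
- rewrite !inE => Aa Aa' ff; apply/eqP.
  by have [-> _] := GP _ _ _ _ (fP _ Aa) (fP _ Aa'); rewrite ff.
- have [a ab] := Gr _ A'b; have [Aa _] := GA _ _ ab.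
  exists a => //; apply/eqP.
  by have [<- _] := GP _ _ _ _ (fP _ Aa) ab.
Qed.

Lemma coded_countable (T : countType) (A : set T) : coded A.
Proof. by exists pickle => x y _ _ /(pcan_inj (@pickleK T)). Qed.

End DenseBlocks.

(** * Maximality of the chain of levels *)

Section ChainOfLevels.
Local Open Scope order_scope.
Local Open Scope classical_set_scope.
Context d (L : orderType d).

Definition is_succ (b : L) : Prop := exists a, immediate_succ a b.

Definition level T (t : T -> L) (x : L) : set T :=
  [set c | t c < x \/ (t c = x /\ is_succ x)].

Lemma level_le T (t : T -> L) x c : level t x c -> t c <= x.
Proof. by case=> [/ltW //|[-> _]]. Qed.

Lemma level_mono T (t : T -> L) x y : x <= y -> level t x `<=` level t y.
Proof.
rewrite le_eqVlt => /orP[/eqP -> //|xy] c cx.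
by left; exact: le_lt_trans (level_le cx) xy.
Qed.

Lemma copies_noMax A p : copies Comega_lt A -> A p ->
  exists2 q, A q & Comega_lt p q.
Proof.
move=> [f [[_ _ fS] fP]] Ap.
have [q Aq fq] := fS ((f p).1 + 1, 0%N)%R I.
exists q => //; apply/(fP _ _ Ap Aq); rewrite /Comega_lt fq /=.
by rewrite ltrDl.
Qed.

Variables (zL : L) (t : Comega -> L).
Hypotheses (Lc : complete_order L) (zLP : is_least setT zL)
  (t_gt : forall c, zL < t c)
  (level_copy : forall x, zL < x -> copies Comega_lt (level t x))
  (succ_inj : forall c c', is_succ (t c) -> t c' = t c -> c' = c)
  (nsucc_max : forall c, ~ is_succ (t c) ->
    forall c', t c' <= t c -> ~ Comega_lt c c')
  (nsucc_rlim : forall c, ~ is_succ (t c) -> ~ exists b, immediate_succ (t c) b)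
  (level_sep : forall x y, x < y -> exists c, level t y c /\ ~ level t x c).

Lemma level_least : level t zL = set0.
Proof.
by apply/seteqP; split=> // c cz; have := level_le cz; rewrite leNgt t_gt.
Qed.

Lemma level_subset x y : level t x `<=` level t y <-> x <= y.
Proof.
split=> [xy|/level_mono //]; rewrite leNgt; apply/negP => /level_sep[c [cx]].
by apply; exact: xy.
Qed.

Lemma level_inj x y : level t x = level t y -> x = y.
Proof.
by move=> e; apply/le_anti/andP; split; apply/level_subset; rewrite e.
Qed.

Lemma level_proper x y : level t x `<` level t y <-> x < y.
Proof.
rewrite ltNge; split=> [[xy nyx]|/negP nyx].
  by apply/negP => /level_subset.
split; last by move=> /level_subset.
by apply/level_subset; rewrite leNgt; apply/negP => /ltW.
Qed.

(** If no such index were greatest, completeness would give a least index [b] whose level is not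
    inside [B]. But the level of [b] would be covered by smaller ones, since an immediate
    predecessor of [b] would be a greatest index after all. *)
Lemma greatest_level_below B : exists2 a, level t a `<=` B &
  forall x, level t x `<=` B -> x <= a.
Proof.
apply: contrapT => nmax.
pose Low := [set x | level t x `<=` B].
have LowN x : Low x -> exists2 y, Low y & x < y.
  move=> Lx; apply: contrapT => h; apply: nmax; exists x => // y Ly.
  by rewrite leNgt; apply/negP => xy; apply: h; exists y.
have [_ [m [_ mP]] nogap] := Lc.
have cutP a b : Low a -> (~` Low) b -> a < b.
  move=> La nLb; rewrite ltNge; apply/negP => /level_mono ba.
  by apply: nLb; exact: subset_trans La.
have [b [nLb bP]] : exists b, is_least (~` Low) b.
  apply: contrapT => nb; apply: (nogap Low (~` Low)); split=> //.
    split=> //; last exact: setUv.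
    - by exists zL; rewrite /Low /= level_least.
    - by exists m => /LowN[y _]; rewrite ltNge mP.
  by move=> [a [La aP]]; have [y /aP ya] := LowN _ La; rewrite ltNge ya.
have ltLow x : x < b -> Low x.
  by move=> xb; apply: contrapT => /bP; rewrite leNgt xb.
apply: (nLb) => c [/ltLow /LowN[y Ly cy]|[_ [a [ab aN]]]].
  by apply: Ly; left.
have [y Ly ay] := LowN _ (ltLow _ ab).
by exfalso; apply: aN; exists y; split=> //; exact: cutP.
Qed.

(** Let [a] be the greatest index with level inside [B]; then [B] lies in every later level. *)
Lemma comparable_copy_is_level B : copies Comega_lt B ->
  (forall x, level t x `<=` B \/ B `<=` level t x) ->
  exists x, B = level t x.
Proof.
move=> Bcopy Bcmp; have [a aB aP] := greatest_level_below B.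
exists a; apply/seteqP; split=> // c Bc.
have Blt x : a < x -> B `<=` level t x.
  by move=> ax; have [/aP|//] := Bcmp x; rewrite leNgt ax.
(* The level of an immediate successor [b] of [a] has at most one point more than that of [a]. If
   [B] had it, [B] would contain the level of [b], against the choice of [a]. *)
have [[b [ab abN]]|nb] := pselect (exists b, immediate_succ a b).
  have sb : is_succ b by exists a.
  have [cb|[cb _]] := Blt _ ab _ Bc; last first.
    have : ~ level t b `<=` B by move=> /aP; rewrite leNgt ab.
    case=> c' [c'b|[c'b _]].
      apply: aB; have : t c' <= a.
        by rewrite leNgt; apply/negP => h; apply: abN; exists (t c').
      rewrite le_eqVlt => /orP[/eqP e|]; last by left.
      have [sa|na] := pselect (is_succ a); first by right.
      by exfalso; apply: (@nsucc_rlim c'); rewrite e //; exists b.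
    by rewrite (@succ_inj c c') // ?cb.
  have : t c <= a.
    by rewrite leNgt; apply/negP => h; apply: abN; exists (t c).
  rewrite le_eqVlt => /orP[/eqP e|]; last by left.
  have [sa|na] := pselect (is_succ a); first by right.
  by exfalso; apply: (@nsucc_rlim c); rewrite e //; exists b.
(* Without an immediate successor of [a], no label in [B] exceeds [a]. An extra point of [B] would
   then carry the non-successor label [a] and be maximal in [B], but a copy has no maximal point. *)
have Ble c' : B c' -> t c' <= a.
  move=> Bc'; rewrite leNgt; apply/negP => ac'; apply: nb; exists (t c').
  split=> // -[x [ax xc']].
  by have := level_le (Blt _ ax _ Bc'); rewrite leNgt xc'.
have := Ble _ Bc; rewrite le_eqVlt => /orP[/eqP e|]; last by left.
have [sa|na] := pselect (is_succ a); first by right.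
have [c' Bc' cc'] := copies_noMax Bcopy Bc.
by exfalso; apply: (@nsucc_max c _ c'); rewrite ?e //; exact: Ble.
Qed.

Theorem maximal_chain_of_levels : exists C : set (set Comega),
    maximal_chain_in (copies Comega_lt `|` [set set0]) C /\
    suborder_iso C (fun A B : set Comega => A `<` B)
                 [set: L] (fun x y : L => x < y).
Proof.
pose C := range (level t); exists C; split.
  split; first split.
  - move=> _ [x _ <-]; have [xz|/level_copy] := leP x zL; last by left.
    right; have -> : x = zL by apply/le_anti; rewrite xz zLP.2.
    exact: level_least.
  - move=> _ _ [x _ <-] [y _ <-].
    by have [/level_proper|/level_proper|->] := ltgtP x y; auto.
  move=> D [DP Dchain] CD; apply/seteqP; split=> // B DB.
  have [Bcopy|->] := DP _ DB; last by exists zL => //; exact: level_least.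
  have [x|x ->] := comparable_copy_is_level Bcopy; last by exists x.
  have Dx : D (level t x) by apply: CD; exists x.
  by have [->|[[? _]|[? _]]] := Dchain _ _ DB Dx; [left|right|left].
have /choice[g gP] : forall A, exists x, C A -> level t x = A.
  by move=> A; have [[x _ xA]|nA] := pselect (C A); [exists x | exists zL].
exists g; split.
  split=> // [A B|x _].
    by rewrite !inE => /gP {2}<- /gP {2}<- ->.
  have Cx : C (level t x) by exists x.
  by exists (level t x) => //; apply: level_inj; exact: gP.
by move=> A B /gP {1}<- /gP {1}<-; exact: level_proper.
Qed.

End ChainOfLevels.

(** * Rationals, naturals and the blocks of [Comega] *)

Lemma rat_between (R : realType) (x y : R) : (x < y)%R ->
  exists2 q : rat, (x < ratr q)%R & (ratr q < y)%R.
Proof.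
by move=> /rat_in_itvoo[q]; rewrite in_itv /= => /andP[xq qy]; exists q.
Qed.

Lemma inj_nat_unbounded (h : nat -> nat) m : injective h ->
  exists i, (m <= h i)%N.
Proof.
move=> hI; apply: contrapT => hm.
have := @uniq_leq_size _ (map h (iota 0 m.+1)) (iota 0 m).
rewrite size_map !size_iota ltnn map_inj_uniq ?iota_uniq // => h0.
suff : false by []; apply: h0 => // _ /mapP[i _ ->].
by rewrite mem_iota /= add0n ltnNge; apply/negP => mi; apply: hm; exists i.
Qed.

Lemma fresh_nat (T : eqType) (x : T) (l : seq (T * nat)) :
  exists i, (x, i) \notin l.
Proof.
exists (sumn [seq p.2 | p <- l]).+1; apply/negP => xl.
suff H (p : T * nat) : p \in l -> (p.2 <= sumn [seq p.2 | p <- l])%N.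
  by have := H _ xl; rewrite ltnn.
elim: l {xl} => //= a l IH; rewrite inE => /orP[/eqP ->|/IH pl].
  exact: leq_addr.
exact: leq_trans pl (leq_addl _ _).
Qed.

Lemma dense_blocks_Comega :
  dense_blocks [set: (rat * nat)%type] (fun c : rat * nat => c.1).
Proof.
split=> [|p _|p _|p q _ _ pq|p _ l].
- by exists (0%R, 0%N).
- by exists (p.1 + 1, 0%N)%R => //=; rewrite ltrDl.
- by exists (p.1 - 1, 0%N)%R => //=; rewrite ltrBlDr ltrDl.
- by exists ((p.1 + q.1) / 2, 0%N)%R => //=; split; rewrite midf_lt.
- by have [i il] := fresh_nat p.1 l; exists (p.1, i).
Qed.

(** * Choice of the labels and of their blocks *)

Section Labels.
Local Open Scope order_scope.
Local Open Scope classical_set_scope.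
Context (R : realType) d (L : orderType d) (zL : L) (f : L -> R).
Hypothesis fP : forall x y, (x < y) <-> (f x < f y)%R.

Lemma embedding_le x y : x <= y -> (f x <= f y)%R.
Proof. by rewrite le_eqVlt => /orP[/eqP -> //|/fP/ltW]. Qed.

(** Each jump of [L] leaves an interval between the values of [f]. Distinct jumps give disjoint
    intervals, so a rational chosen in each is a code. *)
Lemma is_succ_coded : coded (@is_succ d L).
Proof.
have /choice[q qP] : forall b, exists q : rat, is_succ b ->
    exists2 a, immediate_succ a b & (f a < ratr q)%R /\ (ratr q < f b)%R.
  move=> b; have [[a ab]|nb] := pselect (is_succ b); last by exists 0%R.
  have [q aq qb] := rat_between ((fP _ _).1 ab.1).
  by exists q => _; exists a.
exists (pickle \o q).
suff H b b' : is_succ b -> is_succ b' -> b < b' -> q b <> q b'.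
  move=> b b' sb sb' /= /(pcan_inj (@pickleK _)) e.
  have [h|h|//] := ltgtP b b'; first by case: (H _ _ sb sb' h).
  by case: (H _ _ sb' sb h).
move=> /qP[a _ [_ qb]] /qP[a' [_ a'b'] [a'q _]] bb' e.
have ba' : b <= a'.
  by rewrite leNgt; apply/negP => a'b; apply: a'b'; exists b.
have := lt_trans qb (le_lt_trans (embedding_le ba') a'q).
by rewrite e ltxx.
Qed.

Definition jump_free_dense (E : set L) : Prop :=
  [/\ forall e, E e -> ~ is_succ e /\ (exists2 x, x < e & exists y, e < y),
      forall e x, E e -> e < x -> exists2 e', E e' & e < e' /\ e' < x,
      forall e x, E e -> x < e -> exists2 e', E e' & x < e' /\ e' < e &
      forall x y, x < y -> (forall j, x < j -> j <= y -> ~ is_succ j) ->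
        exists2 e, E e & x < e /\ e < y].

(** The countable set [range D] meets every open interval of [L] that has a point. [E] keeps those
    of its elements that lie inside an interval free of successors. *)
Lemma jump_free_dense_exists : exists2 E, coded E & jump_free_dense E.
Proof.
have /choice[D DP] : forall pq : rat * rat, exists e, forall z,
    (ratr pq.1 < f z)%R -> (f z < ratr pq.2)%R ->
    (ratr pq.1 < f e)%R /\ (f e < ratr pq.2)%R.
  move=> [p q]; have [[e [pe eq]]|nz] := pselect (exists e,
    (ratr p < f e)%R /\ (f e < ratr q)%R); first by exists e.
  by exists zL => z pz zq; case: nz; exists z.
have Ddense x z y : x < z -> z < y -> exists2 e, range D e & x < e /\ e < y.
  move=> /fP/rat_between[p xp pz] /fP/rat_between[q zq qy].
  have [pD Dq] := DP (p, q) z pz zq.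
  exists (D (p, q)); first by exists (p, q).
  by split; apply/fP; [exact: lt_trans pD|exact: lt_trans qy].
pose free (x y : L) := forall j, x < j -> j <= y -> ~ is_succ j.
pose E := [set e | range D e /\ exists x y, [/\ x < e, e < y & free x y]].
(* In a successor-free interval two points are never adjacent, so there is room for a point of
   [D]. *)
have nsuccP (x y : L) : x < y -> ~ is_succ y -> exists2 z, x < z & z < y.
  move=> xy ny; apply: contrapT => nz; apply: ny; exists x; split=> //.
  by move=> [z [xz zy]]; apply: nz; exists z.
exists E.
  have /choice[c cP] : forall e, exists pq, range D e -> D pq = e.
    move=> e; have [[pq _ <-]|nD] := pselect (range D e); first by exists pq.
    by exists (0, 0)%R.
  exists (pickle \o c) => x y [Dx _] [Dy _] /= /(pcan_inj (@pickleK _)) e.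
  by rewrite -(cP _ Dx) -(cP _ Dy) e.
split.
- move=> e [_ [x [y [xe ey fr]]]]; split; first by apply: fr => //; exact: ltW.
  by exists x => //; exists y.
- move=> e x [_ [x0 [y0 [xe ey fr]]]] ex.
  have eyx : e < Order.min x y0 by rewrite lt_min ex.
  have [|z ez zy] := nsuccP _ _ eyx.
    by apply: fr; [exact: lt_trans eyx|rewrite ge_min lexx orbT].
  have [e' De' [ee']] := Ddense _ _ _ ez zy.
  rewrite lt_min => /andP[e'x e'y]; exists e' => //; split=> //.
  by exists x0, y0; split=> //; exact: lt_trans ee'.
- move=> e x [_ [x0 [y0 [xe ey fr]]]] x_e.
  have eyx : Order.max x x0 < e by rewrite gt_max x_e.
  have [|z xz ze] := nsuccP _ _ eyx; first by apply: fr => //; exact: ltW.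
  have [e' De' []] := Ddense _ _ _ xz ze.
  rewrite gt_max => /andP[xe' x0e'] e'e; exists e' => //; split=> //.
  by exists x0, y0; split=> //; exact: lt_trans ey.
- move=> x y xy fr; have [|z xz zy] := nsuccP _ _ xy; first exact: fr.
  have [e De [xe ey]] := Ddense _ _ _ xz zy.
  by exists e => //; split=> //; exists x, y.
Qed.

Variable E : set L.
Hypotheses (Ecoded : coded E) (EP : jump_free_dense E)
  (zLP : is_least setT zL).

(** A model of the labelled [Comega]: the second coordinate numbers the points with a given label,
    so a successor gets the single index 0. *)
Definition label_points : set (L * nat) :=
  [set p | E p.1 \/ (is_succ p.1 /\ p.2 = 0%N)].

Definition label_level (x : L) : set (L * nat) :=
  label_points `&` level fst x.

Lemma label_points_coded : coded label_points.
Proof.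
have [kE kEP] := Ecoded; have [kJ kJP] := is_succ_coded.
exists (fun p => pickle (`[< E p.1 >], if `[< E p.1 >] then kE p.1 else kJ p.1,
                         p.2)).
move=> [x i] [y j] Xx Xy /(pcan_inj (@pickleK _)) /= [].
have [Ex|nEx] := asboolP (E x); have [Ey|nEy] := asboolP (E y) => //= _.
  by move=> /(kEP _ _ Ex Ey) -> ->.
case: Xx => //= -[sx _]; case: Xy => //= -[sy _].
by move=> /(kJP _ _ sx sy) -> ->.
Qed.

Lemma label_points_gt p : label_points p -> zL < p.1.
Proof.
have [En _ _ _] := EP; case=> [/En[_ [x xe _]]|[[a [ap _]] _]].
  by apply: le_lt_trans xe; exact: zLP.2.
by apply: le_lt_trans ap; exact: zLP.2.
Qed.

Lemma is_succ_gt j : is_succ j -> zL < j.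
Proof. by move=> sj; apply: (@label_points_gt (j, 0%N)); right. Qed.

(** A successor [j] joins the block of some [b j] in [E] below it. The blocks met by a level are
    then exactly those of the elements of [E] below its index. *)
Lemma block_map_coinitial :
  (forall x, zL < x -> exists2 e, E e & e < x) ->
  exists s : L -> R, [/\ forall e, E e -> s e = f e,
    forall j, is_succ j -> (s j < f j)%R &
    forall x, zL < x -> dense_blocks (label_level x) (fun p => s p.1)].
Proof.
move=> Eco; have [En Er El _] := EP.
have /choice[b bP] : forall x, exists e, zL < x -> E e /\ e < x.
  move=> x; have [xz|/Eco[e Ee ex]] := leP x zL; last by exists e.
  by exists zL.
pose s x := if `[< E x >] then f x else f (b x).
have sE e : E e -> s e = f e by move=> Ee; rewrite /s asboolT.
have sJ j : is_succ j -> s j = f (b j).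
  by move=> sj; rewrite /s asboolF // => /En[].
exists s; split=> // [j sj|x zx].
  by rewrite sJ //; apply/fP; have [] := bP _ (is_succ_gt sj).
have supp p : label_level x p -> exists2 e, E e /\ e < x & s p.1 = f e.
  move=> [[Ep|[sp _]] px].
    exists p.1; last exact: sE.
    by split=> //; case: px => // -[px sx]; case: (En _ Ep); rewrite px.
  have [Eb bp] := bP _ (is_succ_gt sp).
  by exists (b p.1); [split=> //; exact: lt_le_trans (level_le px)|exact: sJ].
have supp' e i : E e -> e < x -> label_level x (e, i).
  by move=> Ee ex; split; left.
split=> [|p|p|p q|p].
- by have [e Ee ex] := Eco _ zx; exists (e, 0%N); exact: supp'.
- move=> /supp[e [Ee ex] ->]; have [e' Ee' [ee' e'x]] := Er _ _ Ee ex.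
  by exists (e', 0%N); [exact: supp'|rewrite /= sE //; exact/fP].
- move=> /supp[e [Ee ex] ->]; have [_ [y ye _]] := En _ Ee.
  have [e' Ee' [_ e'e]] := El _ _ Ee ye.
  exists (e', 0%N); first by apply: supp' => //; exact: lt_trans ex.
  by rewrite /= sE //; exact/fP.
- move=> /supp[e [Ee ex] ->] /supp[e1 [Ee1 e1x] ->] /fP ee1.
  have [e' Ee' [ee' e'e1]] := Er _ _ Ee ee1.
  exists (e', 0%N); first by apply: supp' => //; exact: lt_trans e1x.
  by rewrite /= sE //; split; exact/fP.
- move=> /supp[e [Ee ex] ->] l; have [i il] := fresh_nat e l.
  by exists (e, i); [exact: supp'|rewrite /= sE].
Qed.

(** Step [n] moves below the previous term and below the successor of code [n], if there is one. *)
Lemma decreasing_coinitial_succ :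
  (forall x, zL < x -> exists2 j, is_succ j & j < x) -> (exists x, zL < x) ->
  exists u : nat -> L, [/\ forall n, is_succ (u n),
    forall n m, (n < m)%N -> u m < u n &
    forall x, zL < x -> exists n, u n < x].
Proof.
move=> Jco [x0 x0P]; have [k kP] := is_succ_coded.
have /choice[next nextP] : forall nj : nat * {j : L | is_succ j},
    exists j' : {j : L | is_succ j}, sval j' < sval nj.2 /\
      forall i, is_succ i -> k i = nj.1 -> sval j' < i.
  move=> [n [j sj]] /=.
  have [[i [si ki]]|ni] := pselect (exists i, is_succ i /\ k i = n); last first.
    have [j' sj' j'j] := Jco _ (is_succ_gt sj).
    by exists (exist _ _ sj'); split=> // i si ki; case: ni; exists i.
  have /Jco[j' sj'] : zL < Order.min j i by rewrite lt_min !is_succ_gt.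
  rewrite lt_min => /andP[j'j j'i].
  exists (exist _ _ sj'); split=> //= i' si' ki'.
  by rewrite (kP _ _ si' si) // ki' ki.
have [j0 sj0 _] := Jco _ x0P.
pose v := fix v n : {j : L | is_succ j} :=
  if n is m.+1 then next (m, v m) else exist _ _ sj0.
exists (fun n => sval (v n)); split=> [n|n m|x /Jco[i si ix]].
- exact: svalP.
- elim: m => // m IH; rewrite ltnS leq_eqVlt => /orP[/eqP ->|/IH].
    by have [] := nextP (m, v m).
  by apply: lt_trans; have [] := nextP (m, v m).
- exists (k i).+1; apply: lt_trans ix.
  by have [_] := nextP (k i, v (k i)); exact.
Qed.

(** The new blocks are the rationals below [f zL]. The sequence [u] visits each of them infinitely
    often, hence with labels arbitrarily close to [zL]. *)
Lemma block_map_succ_coinitial :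
  (forall x, zL < x -> exists2 j, is_succ j & j < x) -> (exists x, zL < x) ->
  exists s : L -> R, [/\ forall e, E e -> s e = f e,
    forall j, is_succ j -> (s j < f j)%R &
    forall x, zL < x -> dense_blocks (label_level x) (fun p => s p.1)].
Proof.
move=> Jco Lnt; have [En Er El _] := EP.
have [u [uJ udec uco]] := decreasing_coinitial_succ Jco Lnt.
have uI n m : u n = u m -> n = m.
  by have [/udec|/udec|//] := ltngtP n m => + e; rewrite e ltxx.
have [r0 _ r0P] : exists2 q : rat, (f zL - 1 < ratr q)%R & (ratr q < f zL)%R.
  by apply: rat_between; rewrite ltrBlDr ltrDl.
(* Reading [n] as a pair [(q, i)] and dropping [i] repeats each [q] infinitely often; [r0] is the
   default block. *)
pose r n : rat := if (unpickle n : option (rat * nat)) is Some (q, _) then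
                    if (ratr q < f zL)%R then q else r0
                  else r0.
have rP n : (ratr (r n) < f zL)%R.
  rewrite /r; case: (unpickle n : option (rat * nat)) => [[q i]|] //.
  by case: ifP.
have /choice[s sP] : forall x, exists v, [/\ E x -> v = f x,
    forall n, u n = x -> v = ratr (r n) :> R &
    ~ E x -> exists2 q : rat, v = ratr q & (ratr q < f zL)%R].
  move=> x; have [Ex|nEx] := pselect (E x).
    exists (f x); split=> // n unx.
    by have [] := En _ Ex; rewrite -unx; have := uJ n.
  have [[n unx]|nu] := pselect (exists n, u n = x).
    exists (ratr (r n)); split=> // [m|_]; last by exists (r n).
    by rewrite -unx => /uI ->.
  exists (ratr r0); split=> // [n unx|_]; last by exists r0.
  by case: nu; exists n.
have sE e : E e -> s e = f e by have [] := sP e.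
have sJ j : is_succ j -> exists2 q : rat, s j = ratr q & (ratr q < f zL)%R.
  by have [_ _ h] := sP j => sj; apply: h => /En[].
(* For [i] large the code of [(q, i)] is at least [n0], and [u] decreases. *)
have hit (q : rat) y : (ratr q < f zL)%R -> zL < y ->
    exists2 j, is_succ j & j < y /\ s j = ratr q.
  move=> qz /uco[n0 n0y].
  have [|i ni] := @inj_nat_unbounded (fun i => pickle (q, i)) n0.
    by move=> i i' /(pcan_inj (@pickleK _)) [].
  exists (u (pickle (q, i))); first exact: uJ.
  split.
    apply: le_lt_trans n0y; move: ni; rewrite leq_eqVlt => /orP[/eqP -> //|].
    by move=> /udec/ltW.
  by have [_ /(_ _ erefl) -> _] := sP (u (pickle (q, i))); rewrite /r pickleK qz.
exists s; split=> // [j sj|x zx].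
  have [q -> qz] := sJ _ sj; apply: lt_trans qz _.
  exact/fP/is_succ_gt.
have supp p : label_level x p ->
    (exists2 e, E e /\ e < x & s p.1 = f e) \/
    (exists2 q : rat, (ratr q < f zL)%R & s p.1 = ratr q).
  move=> [[Ep|[sp _]] px]; last first.
    by right; have [q sq qz] := sJ _ sp; exists q.
  left; exists p.1; last exact: sE.
  by split=> //; case: px => // -[px sx]; case: (En _ Ep); rewrite px.
have suppE e i : E e -> e < x -> label_level x (e, i).
  by move=> Ee ex; split; left.
have suppJ j : is_succ j -> j < x -> label_level x (j, 0%N).
  by move=> sj jx; split; [right|left].
have rat_in (q : rat) : (ratr q < f zL)%R ->
    exists2 p, label_level x p & s p.1 = ratr q.
  move=> qz; have [j sj [jx sq]] := hit q x qz zx.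
  by exists (j, 0%N) => //; exact: suppJ.
have fz e : E e -> (f zL < f e)%R.
  by move=> Ee; apply/fP; apply: (@label_points_gt (e, 0%N)); left.
split=> [|p|p|p q|p].
- by have [p xp _] := rat_in _ r0P; exists p.
- move=> /supp[[e [Ee ex] ->]|[q qz ->]].
    have [e' Ee' [ee' e'x]] := Er _ _ Ee ex.
    by exists (e', 0%N); [exact: suppE|rewrite /= sE //; exact/fP].
  have [q' qq' /rat_in[p' xp' sp']] := rat_between qz.
  by exists p' => //; rewrite sp'.
- move=> /supp[[e [Ee ex] ->]|[q qz ->]].
    have [p' xp' sp'] := rat_in _ r0P.
    by exists p' => //; rewrite sp'; exact: lt_trans (fz _ Ee).
  have [|q' _ q'q] := @rat_between _ (ratr q - 1)%R (ratr q : R).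
    by rewrite ltrBlDr ltrDl.
  have [p' xp' sp'] := rat_in _ (lt_trans q'q qz).
  by exists p' => //; rewrite sp'.
- move=> /supp[[e [Ee ex] ->]|[r1 rz ->]] /supp[[e1 [Ee1 e1x] ->]|[r2 r2z ->]].
  + move=> /fP ee1; have [e' Ee' [ee' e'e1]] := Er _ _ Ee ee1.
    exists (e', 0%N); first by apply: suppE => //; exact: lt_trans e1x.
    by rewrite /= sE //; split; exact/fP.
  + by move=> er2; have := lt_trans (fz _ Ee) (lt_trans er2 r2z); rewrite ltxx.
  + move=> _; have [q' rq' q'z] := rat_between rz.
    have [p' xp' sp'] := rat_in _ q'z.
    by exists p' => //; rewrite sp'; split=> //; exact: lt_trans (fz _ Ee1).
  + move=> /rat_between[q' rq' q'r].
    have [p' xp' sp'] := rat_in _ (lt_trans q'r r2z).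
    by exists p' => //; rewrite sp'.
- move=> /supp[[e [Ee ex] ->]|[q qz ->]] l.
    have [i il] := fresh_nat e l.
    by exists (e, i); [exact: suppE|rewrite /= sE].
  (* A successor of block [q] taken below all the labels above [zL] in [l] cannot occur in [l]. *)
  have [y zy yP] : exists2 y, zL < y & forall p', p' \in l -> zL < p'.1 ->
      y <= p'.1.
    elim: l => [|a l [y zy yP]]; first by exists x.
    have [az|za] := leP a.1 zL.
      exists y => // p'; rewrite inE => /orP[/eqP ->|/yP //].
      by rewrite ltNge az.
    exists (Order.min y a.1); first by rewrite lt_min zy.
    move=> p'; rewrite inE => /orP[/eqP -> _|p'l zp'].
      by rewrite ge_min lexx orbT.
    by rewrite ge_min yP.
  have /(hit _ _ qz)[j sj []] : zL < Order.min x y by rewrite lt_min zx.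
  rewrite lt_min => /andP[jx jy] sjq.
  exists (j, 0%N); first exact: suppJ.
  split=> //; apply/negP => jl.
  by have := yP _ jl (is_succ_gt sj); rewrite leNgt jy.
Qed.

(** If [E] misses an initial segment above [zL], an interval there that starts at [zL] cannot be
    successor-free, as it would contain a point of [E]. So the successors are coinitial. *)
Lemma block_map_exists : (exists x, zL < x) ->
  ~ (exists y, immediate_succ zL y) ->
  exists s : L -> R, [/\ forall e, E e -> s e = f e,
    forall j, is_succ j -> (s j < f j)%R &
    forall x, zL < x -> dense_blocks (label_level x) (fun p => s p.1)].
Proof.
move=> Lnt zlim; have [_ _ _ Es] := EP.
have [Eco|nEco] := pselect (forall x, zL < x -> exists2 e, E e & e < x).
  exact: block_map_coinitial.
apply: block_map_succ_coinitial => // x zx.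
have [x0 zx0 nE] : exists2 x0, zL < x0 & ~ exists2 e, E e & e < x0.
  apply: contrapT => h; apply: nEco => y zy.
  by apply: contrapT => h'; apply: h; exists y.
have zm : zL < Order.min x x0 by rewrite lt_min zx.
have [y [zy]] : exists y, zL < y /\ y < Order.min x x0.
  by apply: contrapT => h; apply: zlim; exists (Order.min x x0).
rewrite lt_min => /andP[yx yx0]; apply: contrapT => nj; apply: nE.
have [j zj jy sj|e Ee [_ ey]] := Es _ _ zy.
  by apply: nj; exists j => //; exact: le_lt_trans yx.
by exists e => //; exact: lt_trans yx0.
Qed.

(** The level of the greatest element is all of [label_points]. Its isomorphism [phi] onto [Comega]
    has inverse [psi], and the label of [c] is the first coordinate of [psi c]. *)
Lemma labels_exist (s : L -> R) : (exists m : L, is_greatest setT m) ->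
  (exists x, zL < x) ->
  (forall e, E e -> s e = f e) -> (forall j, is_succ j -> (s j < f j)%R) ->
  (forall x, zL < x -> dense_blocks (label_level x) (fun p => s p.1)) ->
  exists t : Comega -> L, [/\ forall c, zL < t c,
    forall x, zL < x -> copies Comega_lt (level t x),
    forall c c', is_succ (t c) -> t c' = t c -> c' = c,
    forall c, ~ is_succ (t c) ->
      (forall c', t c' <= t c -> ~ Comega_lt c c') /\
      ~ exists b, immediate_succ (t c) b &
    forall x y, x < y -> exists c, level t y c /\ ~ level t x c].
Proof.
move=> [m [_ mP]] [x0 zx0] sE sJ sdense; have [En Er El Es] := EP.
have coded_sub x : coded (label_level x).
  have [k kP] := label_points_coded.
  by exists k => p q [Xp _] [Xq _]; exact: kP.
have iso x : zL < x -> suborder_iso (label_level x)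
    (fun p q => (s p.1 < s q.1)%R) [set: Comega] Comega_lt.
  move=> zx; apply: (dense_blocks_iso (coded_sub x)
    (@coded_countable (rat * nat)%type _) (sdense _ zx) dense_blocks_Comega).
(* The greatest element is not in [E], so as a label it can only be a successor. *)
have Xm : label_level m = label_points.
  apply/seteqP; split=> [p []//|p Xp]; split=> //.
  have := mP p.1 I; rewrite le_eqVlt => /orP[/eqP pm|]; last by left.
  case: Xp => [/En[_ [_ _ [y]]]|[sp _]]; last by right; rewrite -pm.
  by rewrite pm ltNge mP.
have [phi [[_ phiI phiS] phiP]] := iso _ (lt_le_trans zx0 (mP x0 I)).
rewrite Xm in phiI phiS phiP.
have /choice[psi psiP] : forall c, exists p, label_points p /\ phi p = c.
  by move=> c; have [p Xp pc] := phiS c I; exists p.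
have psiX c : label_points (psi c) by have [] := psiP c.
have psiK c : phi (psi c) = c by have [] := psiP c.
have phiK p : label_points p -> psi (phi p) = p.
  by move=> Xp; apply: phiI; rewrite ?inE // psiK.
have psi_lt c c' : Comega_lt c c' <-> (s (psi c).1 < s (psi c').1)%R.
  by rewrite -{1}(psiK c) -{1}(psiK c'); apply: iff_sym; exact: phiP.
exists (fun c => (psi c).1); split.
- by move=> c; exact: label_points_gt.
- move=> x /iso[g [[_ gI gS] gP]]; exists (g \o psi); split.
    split=> // [c c'|c _].
      rewrite !inE => lc lc' /= /gI; rewrite !inE => e.
      by rewrite -(psiK c) -(psiK c') e.
    have [p [Xp px] pc] := gS c I.
    exists (phi p); last by rewrite /= phiK.
    by rewrite /level /= phiK.
  move=> c c' lc lc'; apply: (iff_trans (psi_lt _ _)); exact: gP.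
- move=> c c' sc e; rewrite -(psiK c) -(psiK c'); congr phi.
  have nE : ~ E (psi c).1 by move=> /En[].
  have [//|[_ c0]] := psiX c; have [|[_ c'0]] := psiX c'; first by rewrite e.
  by rewrite (surjective_pairing (psi c)) (surjective_pairing (psi c')) e c0 c'0.
- move=> c nsc; have Ec : E (psi c).1 by have [//|[]] := psiX c.
  split=> [c' c'c|[b [cb nb]]]; last first.
    by have [e' _ ?] := Er _ _ Ec cb; apply: nb; exists e'.
  (* Since [s] is at most [f] on labels, with equality on [E], a point above one labelled in [E] has
     a strictly greater label. *)
  move=> /psi_lt; rewrite (sE _ Ec) => lt1.
  have : (s (psi c').1 <= f (psi c').1)%R.
    by have [/sE ->|[/sJ/ltW]] := psiX c'.
  move=> le1; have := lt_le_trans lt1 (le_trans le1 (embedding_le c'c)).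
  by rewrite ltxx.
- move=> x y xy.
  (* The separating label is a successor in the interval from [x] to [y], or else a point of [E]
     inside it. *)
  have [[j [xj jy sj]]|nj] :=
      pselect (exists j, [/\ x < j, j <= y & is_succ j]).
    have Xj : label_points (j, 0%N) by right.
    exists (phi (j, 0%N)); rewrite /level /= phiK //=; split.
      by move: jy; rewrite le_eqVlt => /orP[/eqP <-|]; [right|left].
    by case=> [|[jx _]]; [rewrite ltNge (ltW xj)|move: xj; rewrite jx ltxx].
  have [j xj jy sj|e Ee [xe ey]] := Es _ _ xy; first by apply: nj; exists j.
  have Xe : label_points (e, 0%N) by left.
  exists (phi (e, 0%N)); rewrite /level /= phiK //=; split; first by left.
  by case=> [|[ex _]]; [rewrite ltNge (ltW xe)|move: xe; rewrite ex ltxx].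
Qed.

End Labels.

(** * Assembly of the labelling and the chain *)

Theorem theorem6p2 (R : realType) (d : Order.disp_t) (L : orderType d)
    (zL : L) (L_embeddable : embeddable_in_reals L R)
    (L_complete : complete_order L) (zL_non_isolated : non_isolated_least zL) :
  exists C : set (set Comega),
    maximal_chain_in (copies Comega_lt `|` [set set0]) C /\
    suborder_iso C (fun A B : set Comega => A `<` B)
                 [set: L] (fun x y : L => (x < y)%O).
Proof.
have [f fP] := L_embeddable; have [zLP Lnt zlim] := zL_non_isolated.
have [_ Lmax _] := L_complete.
have [E Ecoded EP] := jump_free_dense_exists zL fP.
have [s [sE sJ sdense]] := block_map_exists fP EP zLP Lnt zlim.
have [t [t_gt t_copy t_succ t_nsucc t_sep]] :=
  labels_exist fP Ecoded EP zLP Lmax Lnt sE sJ sdense.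
apply: (maximal_chain_of_levels L_complete zLP t_gt t_copy t_succ) => //.
  by move=> c /t_nsucc[].
by move=> c /t_nsucc[].
Qed.
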